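(* Let $\mathscr{A}$ be a $C^*$-algebra with unit $e$ and let $a\in\mathscr{A}$. Then for all $n=2,3,\ldots$, $$v^n(a)\leq\sum_{i=1}^{n-1}\frac{1}{2^i}\|a^i\|\,\|a\|^{n-i}+\frac{1}{2^{n-1}}v(a^n).$$
   Context: $\mathcal{S}(\mathscr{A})$ is the state space of $\mathscr{A}$, i.e. the set of positive linear functionals $\varphi$ on $\mathscr{A}$ with $\varphi(e)=1$. The numerical radius of $a\in\mathscr{A}$ is $v(a)=\sup\{|\varphi(a)|:\varphi\in\mathcal{S}(\mathscr{A})\}$, and $v^n(a)$ means $(v(a))^n$. $\|\cdot\|$ is the $C^*$-norm. *)

(* Defs.v *)
From HB Require Import structures.
From mathcomp Require Import all_boot all_order all_algebra.
From mathcomp Require Import complex.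
From mathcomp Require Import all_classical all_reals all_analysis.

Set Implicit Arguments.
Unset Strict Implicit.
Unset Printing Implicit Defensive.

Import Order.TTheory GRing.Theory Num.Theory.
Import numFieldNormedType.Exports.
Import Normc.

Local Open Scope classical_set_scope.
Local Open Scope ring_scope.
Local Open Scope complex_scope.

(* The norm is a field of this mixin, with values in R, rather than the norm of
   a normedModType R[i]: in the MathComp hierarchy the join of a ring and a
   normed Z-module is numDomainType, so Hierarchy-Builder rejects a structure
   that is both an algebra and a normed module.
   The field cnorm_complete is completeness: every Cauchy sequence converges in
   norm. Here c^* is the complex conjugate and normc c the modulus of c. *)
HB.mixin Record isCStarAlgebra (R : realType) A of GRing.Algebra R[i] A := {
  cnorm : A -> R ;
  cnorm_eq0 : forall a, cnorm a = 0 -> a = 0 ;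
  cnormZ : forall (c : R[i]) (a : A), cnorm (c *: a) = normc c * cnorm a ;
  cnormD : forall a b : A, cnorm (a + b) <= cnorm a + cnorm b ;
  cnormM : forall a b : A, cnorm (a * b) <= cnorm a * cnorm b ;
  cnorm_complete : forall u : nat -> A,
    (forall e : R, 0 < e -> exists N : nat, forall m n : nat,
      (N <= m)%N -> (N <= n)%N -> cnorm (u m - u n) < e) ->
    exists l : A, cnorm (u n - l) @[n --> \oo] --> (0 : R) ;
  star : A -> A ;
  starD : forall a b : A, star (a + b) = star a + star b ;
  starZ : forall (c : R[i]) (a : A), star (c *: a) = c^* *: star a ;
  starM : forall a b : A, star (a * b) = star b * star a ;
  starK : forall a : A, star (star a) = a ;
  cnorm_star : forall a : A, cnorm (star a * a) = cnorm a ^+ 2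
}.

(* Unital C*-algebras over the complex numbers R[i]. The unit e is 1, and
   1 != 0 is part of the ring structure. *)
#[short(type="cstarAlgType")]
HB.structure Definition CStarAlgebra (R : realType) :=
  {A of isCStarAlgebra R A & GRing.Algebra R[i] A}.

(* In R[i], [0 <= z] means that z is real and nonnegative. *)
Definition positive_functional (R : realType) (A : cstarAlgType R)
    (phi : {scalar A}) : Prop :=
  forall a : A, 0 <= phi (star a * a).

Definition state_space (R : realType) (A : cstarAlgType R) :
    set {scalar A} :=
  [set phi | positive_functional phi /\ phi 1 = 1].

Definition numerical_radius (R : realType) (A : cstarAlgType R) (a : A) : R :=
  sup [set normc (phi a) | phi in @state_space R A].

(* Main.v *)
Require Import Defs.
From mathcomp Require Import all_boot all_order all_algebra.
From mathcomp Require Import complex.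
From mathcomp Require Import all_classical all_reals all_analysis.
From mathcomp Require Import ring lra.
Import Order.TTheory GRing.Theory Num.Theory.
Import ComplexField.Normc.
Local Open Scope ring_scope.

(** For a state [phi], the form [(x, y) |-> phi (star x * y)] is a semi-inner
    product in which [1] is a unit vector, so Buzano's extension of the
    Cauchy-Schwarz inequality gives
      [2 |phi a| |phi b| <= ||a|| ||b|| + |phi (a * b)|]
    ([state_buzano]). Taking [b = a ^+ n] bounds [|phi a| |phi (a ^+ n)|] by
    half of [||a|| ||a ^+ n|| + |phi (a ^+ n.+1)|]. Multiplying the claim for
    [n], stated for the single state [phi], by [|phi a| <= ||a||] and applying
    this to the last term gives the claim for [n.+1] ([state_power_bound]); the
    supremum over the states is taken only at the end, because the step from
    [n] to [n.+1] needs one and the same state in both factors.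

    Buzano's inequality itself is Cauchy-Schwarz for [star a] and the reflection
    [b' = 2 phi(b) 1 - b] of [b] in the line of [1]: the reflection preserves
    the form ([state_reflection]), and [phi (a * b') + phi (a * b)] equals
    [2 phi(a) phi(b)].

    Turning [phi (star x * x)] into norms needs [phi (star x * x) <= ||x||^2]
    ([state_star_mul_le]). For [M > ||x||^2] the element
    [1 - M^-1 *: (star x * x)] has the form [star b * b], so that positivity of
    [phi] at [b] gives [phi (star x * x) <= M]. The element [b] is a self-adjoint
    square root ([sqrt_one_sub]), found as a fixed point of a contraction; this is
    where completeness of the algebra enters. *)

(** * Norm and involution *)

Section Norm.
Variables (R : realType) (A : cstarAlgType R).
Implicit Types a b x y : A.

Lemma cnorm0 : cnorm (0 : A) = 0.
Proof. by rewrite -(scale0r (0 : A)) cnormZ normc0 mul0r. Qed.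

Lemma cnormN a : cnorm (- a) = cnorm a.
Proof.
by rewrite -scaleN1r cnormZ normcN normc1 mul1r.
Qed.

Lemma cnormB a b : cnorm (a - b) = cnorm (b - a).
Proof. by rewrite -cnormN opprB. Qed.

Lemma cnorm_triangle a b x : cnorm (a - b) <= cnorm (a - x) + cnorm (x - b).
Proof. by have := cnormD (a - x) (x - b); rewrite addrA subrK. Qed.

Lemma cnorm_ge0 a : 0 <= cnorm a.
Proof. by have := cnormD a (- a); rewrite subrr cnorm0 cnormN; lra. Qed.

(** The C*-identity gives [||a||^2 <= ||star a|| ||a||]; [star] is an
    involution, so the bound goes both ways. *)
Lemma cnorm_involution a : cnorm (star a) = cnorm a.
Proof.
have le_star x : cnorm x <= cnorm (star x).
  have := cnormM (star x) x; rewrite cnorm_star expr2.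
  have := cnorm_ge0 x; rewrite le_eqVlt => /predU1P[<- _|x_gt0].
    exact: cnorm_ge0.
  by rewrite ler_pM2r.
by apply/eqP; rewrite eq_le le_star -{2}(starK a) le_star.
Qed.

Lemma starB a b : star (a - b) = star a - star b.
Proof. by apply/eqP; rewrite eq_sym subr_eq -starD subrK. Qed.

Lemma starZ_real (c : R[i]) a : c \is Num.real -> star (c *: a) = c *: star a.
Proof. by move=> c_real; rewrite starZ (conj_Creal c_real). Qed.

Lemma star1 : star (1 : A) = 1.
Proof. by rewrite -[LHS]mulr1 -{2}(starK 1) -starM mulr1 starK. Qed.

End Norm.

(** * Square roots by iteration *)

(** Banach's fixed point theorem, started at [0]. The ball of radius [r]
    serves as domain and [r] itself as contraction constant, so that the
    iterates satisfy [||u_(n+k) - u_n|| <= r ^+ n ||u_k|| <= r ^+ n]. *)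
Lemma ball_contraction_fixpoint (R : realType) (A : cstarAlgType R)
    (T : A -> A) (r : R) :
  0 <= r < 1 ->
  (forall x, cnorm x <= r -> cnorm (T x) <= r) ->
  (forall x y, cnorm x <= r -> cnorm y <= r ->
    cnorm (T x - T y) <= r * cnorm (x - y)) ->
  exists l, cnorm l <= r /\ T l = l.
Proof.
move=> /andP[r_ge0 r_lt1] Tball Tcontr.
pose u n := iter n T 0.
have u_ball n : cnorm (u n) <= r.
  by elim: n => [|n IH]; [rewrite cnorm0|exact: Tball].
have u_shift n k : cnorm (u (n + k)%N - u n) <= r ^+ n.
  elim: n => [|n IH]; first by rewrite subr0 expr0 (le_trans (u_ball _))// ltW.
  rewrite addSn exprS; apply: le_trans (Tcontr _ _ (u_ball _) (u_ball _)) _.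
  exact: ler_wpM2l.
have r_to0 e : 0 < e -> exists N, forall n, (N <= n)%N -> r ^+ n < e.
  move=> e_gt0.
  have /cvgr_lt/(_ _ e_gt0)[N _ HN] : (r ^+ n @[n --> \oo] --> 0)%classic.
    by apply: cvg_expr; rewrite ger0_norm.
  by exists N => n Nn; exact: HN.
have [|l u_to_l] := @cnorm_complete R A u.
  move=> e e_gt0; have [N HN] := r_to0 _ e_gt0; exists N => m n Nm Nn.
  wlog nm : m n Nm Nn / (n <= m)%N => [H|].
    by have [|/ltnW] := leqP n m => ?; [|rewrite cnormB]; exact: H.
  by apply: le_lt_trans (HN _ Nn); rewrite -(subnKC nm) u_shift.
have close e : 0 < e -> exists n, cnorm (u n - l) < e /\ cnorm (u n.+1 - l) < e.
  move=> e_gt0; have /cvgr_lt/(_ _ e_gt0)[N _ HN] := u_to_l.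
  by exists N; split; apply: HN => /=.
have l_ball : cnorm l <= r.
  apply/ler_addgt0Pl => e /close[n [ule _]].
  have := cnorm_triangle _ _ l 0 (u n); rewrite !subr0 cnormB => /le_trans; apply.
  by rewrite lerD// ltW.
exists l; split => //; apply/eqP; rewrite -subr_eq0; apply/eqP/cnorm_eq0/eqP.
rewrite eq_le cnorm_ge0 andbT; apply/ler_addgt0Pl => e e_gt0; rewrite addr0.
have [|n [ule uSle]] := close (e / 2); first by lra.
have := cnorm_triangle _ _ (T l) l (u n.+1).
have := Tcontr _ _ l_ball (u_ball n); rewrite -[T (u n)]/(u n.+1).
have := ler_wpM2r (cnorm_ge0 _ _ (u n - l)) (ltW r_lt1).
rewrite (cnormB _ _ l); lra.
Qed.

(** With [b = 1 - y], the equation [b ^+ 2 = 1 - h] reads [y = (h + y ^+ 2) / 2].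
    Since [x^2 - y^2 = x (x - y) + (x - y) y], the right-hand side is a
    contraction on every ball of radius less than [1], without any assumption
    of commutativity. It commutes with [star], so its fixed point, being unique,
    is self-adjoint. *)
Lemma sqrt_one_sub (R : realType) (A : cstarAlgType R) (h : A) :
  star h = h -> cnorm h < 1 -> exists b : A, 1 - h = star b * b.
Proof.
move=> hsa; set s := cnorm h => s_lt1.
have s_ge0 : 0 <= s := cnorm_ge0 _ _ h.
(* Any [r < 1] with [s + r ^+ 2 <= 2 * r] gives an invariant ball. *)
pose r := (1 + s) / 2.
pose T (y : A) := (2^-1 : R[i]) *: (h + y * y).
have norm_half : normc (2^-1 : R[i]) = 2^-1.
  by rewrite normcV (normcMn 1 2) normc1.
have r01 : 0 <= r < 1 by rewrite /r; lra.
have [r_ge0 r_lt1] := andP r01.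
have Tball x : cnorm x <= r -> cnorm (T x) <= r.
  move=> xr; rewrite cnormZ norm_half.
  have := cnormD h (x * x); have := cnormM x x.
  have := ler_pM (cnorm_ge0 _ _ x) (cnorm_ge0 _ _ x) xr xr; rewrite -/s.
  have -> : r * r = 2 * r - s - (1 - s) * (3 + s) / 4 by rewrite /r; field.
  have : 0 <= (1 - s) * (3 + s) by apply: mulr_ge0; lra.
  lra.
have Tcontr x y : cnorm x <= r -> cnorm y <= r ->
    cnorm (T x - T y) <= r * cnorm (x - y).
  move=> xr yr; rewrite /T -scalerBr cnormZ norm_half.
  have -> : h + x * x - (h + y * y) = x * (x - y) + (x - y) * y.
    by rewrite mulrBr mulrBl addrA subrK opprD addrACA subrr add0r.
  have := cnormD (x * (x - y)) ((x - y) * y).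
  have := cnormM x (x - y); have := cnormM (x - y) y.
  have := ler_wpM2r (cnorm_ge0 _ _ (x - y)) xr.
  have := ler_wpM2l (cnorm_ge0 _ _ (x - y)) yr.
  lra.
have [y [y_ball Ty]] := ball_contraction_fixpoint _ _ T r r01 Tball Tcontr.
have T_star x : T (star x) = star (T x).
  by rewrite /T starZ_real ?starD ?starM ?hsa// rpredV realn.
(* [star y] and [y] are fixed points in the same ball, hence equal. *)
have ysa : star y = y.
  apply/eqP; rewrite -subr_eq0; apply/eqP/cnorm_eq0/eqP.
  rewrite eq_le cnorm_ge0 andbT leNgt; apply/negP => d_gt0.
  have := Tcontr (star y) y; rewrite cnorm_involution T_star Ty.
  move=> /(_ y_ball y_ball); rewrite leNgt => /negP; apply.
  by rewrite gtr_pMl.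
exists (1 - y); rewrite starB star1 ysa mulrBr mulr1 mulrBl mul1r.
have h_eq : h = y + y - y * y.
  apply/eqP; rewrite eq_sym subr_eq; apply/eqP; rewrite -{1 2}Ty /T -scalerDl.
  have -> : 2^-1 + 2^-1 = 1 :> R[i] by field.
  by rewrite scale1r.
by rewrite h_eq !opprB opprD !addrA addrAC; rewrite addrAC.
Qed.

(** * Cauchy-Schwarz for positive functionals *)

(** The scalar content of the Cauchy-Schwarz inequality: [form_ge0] is the
    positivity of [x + c y], where [p], [q], [z] and [w] stand for the values of
    the form at [(x, x)], [(y, y)], [(x, y)] and [(y, x)]. *)
Section QuadraticForm.
Variables (C : numClosedFieldType) (p q z w : C).
Hypothesis form_ge0 : forall c : C, 0 <= p + c * z + c^* * w + c^* * c * q.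

(** The values at [c = 1] and [c = 'i] are real, hence so are [z + w] and
    ['i * (z - w)]. *)
Lemma quadratic_form_hermitian : p \is Num.real -> q \is Num.real -> w = z^*.
Proof.
move=> p_real q_real.
have E1 : (z + w)^* = z + w.
  apply/conj_Creal.
  have := ger0_real (form_ge0 1); rewrite rmorph1 !mul1r => H.
  have -> : z + w = p + z + w + q - p - q by ring.
  by rewrite !rpredB.
have E2 : ('i * (z - w))^* = 'i * (z - w).
  apply/conj_Creal.
  have := ger0_real (form_ge0 'i).
  rewrite conjCi !mulNr -expr2 sqrCi mulN1r opprK => H.
  have -> : 'i * (z - w) = p + 'i * z - 'i * w + q - p - q by ring.
  by rewrite !rpredB.
move: E2; rewrite rmorphM /= conjCi mulNr -mulrN => /(mulfI (neq0Ci _)).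
move: E1; rewrite !rmorphB !rmorphD /= => E1 E2.
have : 2 * w = 2 * z^*.
  have -> : 2 * w = (z + w) - (z - w) by ring.
  by rewrite -E1 -E2; ring.
by apply: mulfI; rewrite pnatr_eq0.
Qed.

(** Taking [c = - t z^*] with [t] real leaves a real quadratic in [t]; its
    minimum is at [t = q^-1] when [q != 0], and it is affine in [t] when
    [q = 0], which forces [z = 0]. *)
Lemma quadratic_form_discriminant : 0 <= p -> 0 <= q -> `|z| ^+ 2 <= p * q.
Proof.
move=> p_ge0 q_ge0.
have w_eq := quadratic_form_hermitian (ger0_real p_ge0) (ger0_real q_ge0).
have real_expand (t : C) : t \is Num.real ->
    0 <= p - 2 * t * `|z| ^+ 2 + t ^+ 2 * q * `|z| ^+ 2.
  move=> t_real; rewrite normCK; have := form_ge0 (- (t * z^*)).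
  rewrite w_eq rmorphN rmorphM /= conjCK (conj_Creal t_real).
  by congr (0 <= _); ring.
have [q0|q_neq0] := eqVneq q 0.
  rewrite q0 mulr0 le_eqVlt; apply/orP; left.
  apply/negPn/negP => z_neq0.
  (* This [t] makes the affine function equal to [- (p + 2)]. *)
  have := real_expand ((p + 1) / `|z| ^+ 2).
  rewrite q0 mulr0 mul0r addr0 mulrA divfK// => H.
  have : 0 <= - (p + 2).
    have -> : - (p + 2) = p - 2 * (p + 1) by ring.
    by apply: H; rewrite ger0_real// divr_ge0// ?exprn_ge0// addr_ge0.
  by rewrite oppr_ge0 lt_geF// ltr_wpDl.
have q_gt0 : 0 < q by rewrite lt_def q_neq0.
have := real_expand q^-1; rewrite ger0_real ?invr_ge0// => /(_ isT).
have -> : p - 2 * q^-1 * `|z| ^+ 2 + q^-1 ^+ 2 * q * `|z| ^+ 2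
   = p - `|z| ^+ 2 / q by field.
by rewrite subr_ge0 ler_pdivrMr.
Qed.

End QuadraticForm.

Section PositiveFunctional.
Variables (R : realType) (A : cstarAlgType R) (phi : {scalar A}).
Hypothesis phi_ge0 : positive_functional phi.
Implicit Types a b x y : A.

Lemma positive_expand x y (c : R[i]) :
  0 <= phi (star x * x) + c * phi (star x * y) + c^* * phi (star y * x)
       + c^* * c * phi (star y * y).
Proof.
move: (phi_ge0 (x + c *: y)) => H.
rewrite starD starZ mulrDl !mulrDr -!scalerAl -!scalerAr in H.
rewrite !linearD !linearZ /= in H.
by rewrite !addrA mulrA in H.
Qed.

Lemma positive_hermitian x y : phi (star y * x) = (phi (star x * y))^*.
Proof.
by apply: (quadratic_form_hermitian _ _ _ _ _ (positive_expand x y));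
  exact: ger0_real (phi_ge0 _).
Qed.

Lemma cauchy_schwarz x y :
  `|phi (star x * y)| ^+ 2 <= phi (star x * x) * phi (star y * y).
Proof.
exact: (quadratic_form_discriminant _ _ _ _ _ (positive_expand x y)
  (phi_ge0 x) (phi_ge0 y)).
Qed.

(** * Norm bounds for states *)

Hypothesis phi1 : phi 1 = 1.
Local Open Scope complex_scope.

(** [M - star x * x] is [M] times some [star b * b] as soon as
    [M > ||x||^2], and [phi] is nonnegative there. *)
Lemma state_star_mul_le x : phi (star x * x) <= (cnorm x ^+ 2)%:C.
Proof.
have : phi (star x * x) \is Num.real := ger0_real (phi_ge0 x).
move=> /complex_realP[k phi_k]; rewrite phi_k lecR; apply/ler_addgt0Pl => e e_gt0.
set M := e + _.
have M_gt0 : 0 < M by rewrite ltr_wpDr ?exprn_ge0 ?cnorm_ge0.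
pose h := (M^-1)%:C *: (star x * x).
have [||b hb] := sqrt_one_sub _ _ h.
- by rewrite /h starZ_real ?starM ?starK//; apply/complex_realP; exists M^-1.
- rewrite cnormZ cnorm_star /= /normc /=.
  rewrite expr0n addr0 sqrtr_sqr ger0_norm ?invr_ge0 ?ltW//.
  by rewrite mulrC ltr_pdivrMr// mul1r /M ltrDr.
have := phi_ge0 b; rewrite -hb linearB linearZ /= phi1 phi_k.
rewrite -rmorphM -(rmorph1 (real_complex R)) -rmorphB ler0c subr_ge0.
by rewrite mulrC ler_pdivrMr// mul1r.
Qed.

(** [(2 * phi x) *: 1 - x] is the reflection of [x] in the line of the unit
    vector [1], an isometry of the semi-inner product. *)
Lemma state_reflection x :
  phi (star ((2 * phi x) *: 1 - x) * ((2 * phi x) *: 1 - x)) = phi (star x * x).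
Proof.
have phi_star : phi (star x) = (phi x)^*.
  by have := positive_hermitian 1 x; rewrite star1 mulr1 mul1r.
rewrite starB starZ star1 mulrBl !mulrBr -!scalerAl -!scalerAr !mul1r !mulr1.
have phiZ c y : phi (c *: y) = c * phi y by rewrite linearZ.
rewrite !linearB !phiZ phi1 phi_star rmorphM rmorph_nat /=; ring.
Qed.

(** Keeping [phi (star x * x)] on the right, instead of bounding it by
    [cnorm x ^+ 2], is what allows a reflected [x]: the reflection preserves
    that value but need not preserve the norm. *)
Lemma state_norm_mul_le a x :
  normc (phi (a * x)) <= cnorm a * Num.sqrt (complex.Re (phi (star x * x))).
Proof.
have q_real : (complex.Re (phi (star x * x)))%:C = phi (star x * x).
  by apply: RRe_real; exact: ger0_real (phi_ge0 x).
set q := complex.Re _ in q_real *.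
have q_ge0 : 0 <= q by rewrite -ler0c q_real phi_ge0.
rewrite -(@ler_pXn2r _ 2) ?nnegrE ?mulr_ge0 ?cnorm_ge0 ?sqrtr_ge0//; last first.
  by rewrite -ler0c; exact: normr_ge0 (phi (a * x)).
rewrite exprMn sqr_sqrtr// -lecR rmorphXn rmorphM /= q_real.
have := cauchy_schwarz (star a) x; rewrite starK => /le_trans; apply.
apply: ler_wpM2r; first exact: phi_ge0.
by have := state_star_mul_le (star a); rewrite starK cnorm_involution.
Qed.

Lemma sqrt_state_le x :
  Num.sqrt (complex.Re (phi (star x * x))) <= cnorm x.
Proof.
have := state_star_mul_le x; rewrite lecE /= => /andP[_].
by move=> /ler_wsqrtr; rewrite sqrtr_sqr ger0_norm// cnorm_ge0.
Qed.

Lemma state_norm_le a : normc (phi a) <= cnorm a.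
Proof.
have := state_norm_mul_le a 1; rewrite mulr1 star1 mulr1 phi1.
by rewrite sqrtr1 mulr1.
Qed.

Lemma state_buzano a b :
  2 * (normc (phi a) * normc (phi b)) <=
    cnorm a * cnorm b + normc (phi (a * b)).
Proof.
set b' := (2 * phi b) *: 1 - b.
have : normc (phi (a * b')) <= cnorm a * cnorm b.
  apply: le_trans (state_norm_mul_le _ _) _; rewrite state_reflection.
  by apply: ler_wpM2l (sqrt_state_le b); exact: cnorm_ge0.
have : normc (phi (a * b') + phi (a * b)) <=
    normc (phi (a * b')) + normc (phi (a * b)).
  exact: le_normcD.
have -> : phi (a * b') + phi (a * b) = 2 * (phi a * phi b).
  rewrite mulrBr linearB subrK -scalerAr mulr1 linearZ /=; ring.
rewrite !normcM (normcMn 1 2) normc1; lra.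
Qed.

(** The last term of the bound for [n], multiplied by [normc (phi a)], is
    [2^-(n-1)] times a product to which Buzano's inequality applies; it yields
    the new summand [i = n] and the new last term. *)
Lemma state_power_bound a n : (0 < n)%N ->
  normc (phi a) ^+ n <=
    \sum_(1 <= i < n) (1 / 2 ^+ i) * cnorm (a ^+ i) * cnorm a ^+ (n - i)
    + (1 / 2 ^+ (n - 1)) * normc (phi (a ^+ n)).
Proof.
have phia_ge0 : 0 <= normc (phi a) by rewrite -ler0c; exact: (normr_ge0 (phi a)).
elim: n => // -[_ _|n IH _]; first by rewrite big_geq// subnn divr1 mul1r add0r.
rewrite exprS big_nat_recr//= subSnn expr1 !subn1 /=.
apply: le_trans (ler_wpM2l phia_ge0 (IH isT)) _; rewrite subn1 /=.
rewrite mulrDr -addrA; apply: lerD.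
  rewrite mulr_sumr; apply: ler_sum_nat => i /andP[_ /ltnW i_n].
  rewrite (subSn i_n) exprS mulrCA; apply: ler_wpM2l.
    by rewrite mulr_ge0 ?cnorm_ge0// divr_ge0// exprn_ge0.
  by apply: ler_wpM2r (state_norm_le a); rewrite exprn_ge0 ?cnorm_ge0.
have := state_buzano a (a ^+ n.+1); rewrite -exprS => H.
have -> : 1 / 2 ^+ n = 2 * (1 / 2 ^+ n.+1) :> R.
  by rewrite exprS; field; rewrite expf_neq0// pnatr_eq0.
have k_ge0 : 0 <= 1 / 2 ^+ n.+1 :> R by rewrite divr_ge0// exprn_ge0.
have := ler_wpM2l k_ge0 H; lra.
Qed.

End PositiveFunctional.

(** * The numerical radius *)

Lemma numerical_radius_ub (R : realType) (A : cstarAlgType R) (a : A) :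
  ubound [set normc (phi a) | phi in @state_space R A]%classic (cnorm a).
Proof. by move=> _ [phi [phi_ge0 phi1] <-]; exact: state_norm_le. Qed.

(** Also valid for sets that are empty or unbounded, where [sup] is [0]. *)
Lemma sup_ge0 (R : realType) (E : set R) :
  (forall x, E x -> 0 <= x) -> 0 <= sup E.
Proof.
move=> E_ge0; have [[[x Ex] E_ub]|/sup_out->//] := pselect (has_sup E).
exact: le_trans (E_ge0 _ Ex) (ub_le_sup E_ub Ex).
Qed.

(** Each [x] in [E] is at most the [n]-th root of [B], hence so is [sup E];
    for the empty set, where [sup E] is [0], the claim reads [0 <= B]. *)
Lemma exprn_sup_le (R : realType) (E : set R) (n : nat) (B : R) :
  (0 < n)%N -> 0 <= B -> (forall x, E x -> 0 <= x) ->
  (forall x, E x -> x ^+ n <= B) -> sup E ^+ n <= B.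
Proof.
move=> n_gt0 B_ge0 E_ge0 EB.
have [->|/set0P[x0 Ex0]] := eqVneq E set0.
  by rewrite sup0 expr0n gtn_eqF.
pose r := B `^ n%:R^-1.
have rn : r ^+ n = B.
  by rewrite -powR_mulrn ?powR_ge0// -powRrM mulVf ?powRr1// pnatr_eq0 -lt0n.
have Er : ubound E r.
  move=> x Ex; rewrite -(@ler_pXn2r _ n) ?nnegrE ?powR_ge0 ?E_ge0//.
  by rewrite rn EB.
rewrite -rn ler_pXn2r ?nnegrE ?powR_ge0 ?sup_ge0//.
by apply: ge_sup Er; exists x0.
Qed.

Theorem theorem2p6 (R : realType) (A : cstarAlgType R) (a : A) (n : nat)
  (hn : (2 <= n)%N) :
  numerical_radius a ^+ n <=
    \sum_(1 <= i < n) (1 / 2 ^+ i) * cnorm (a ^+ i) * cnorm a ^+ (n - i)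
    + (1 / 2 ^+ (n - 1)) * numerical_radius (a ^+ n).
Proof.
have n_gt0 : (0 < n)%N by exact: leq_trans hn.
have normc_ge0 (z : R[i]) : 0 <= normc z by rewrite -ler0c; exact: normr_ge0 z.
have radius_ge0 (b : A) : 0 <= numerical_radius b.
  by apply: sup_ge0 => _ [phi _ <-]; exact: normc_ge0.
apply: exprn_sup_le => //.
- apply: addr_ge0; last by rewrite mulr_ge0// divr_ge0// exprn_ge0.
  apply: sumr_ge0 => i _.
  by rewrite !mulr_ge0 ?exprn_ge0 ?cnorm_ge0// divr_ge0// exprn_ge0.
- by move=> _ [phi _ <-]; exact: normc_ge0.
move=> _ [phi [phi_ge0 phi1] <-].
apply: le_trans (state_power_bound _ _ _ phi_ge0 phi1 a n n_gt0) _.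
rewrite lerD2l; apply: ler_wpM2l; first by rewrite divr_ge0// exprn_ge0.
apply: ub_le_sup; last by exists phi.
by exists (cnorm (a ^+ n)); exact: numerical_radius_ub.
Qed.
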